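(* Let $n \geq 3$ be an odd integer, let $m \geq 4$ be an even integer, and let $v = m(n+1)$. Then for every integer $\ell$ with $0 \leq \ell \leq \frac{m-2}{2}$, setting $$r = 2n\ell + (m+2n-1), \qquad s = (n+1)\left(\tfrac{m-2}{2}-\ell\right),$$ there exists a $(K_2,K_{1,n})$-$URD(K_v;r,s)$.
   Context: $K_v$ is the complete graph on $v$ vertices, and $K_{1,n}$ is the star with one center and $n$ leaves (it has $n+1$ vertices). For a graph $G$ and graphs $H_1,H_2$, an $(H_1,H_2)$-$URD(G;r,s)$ (uniformly resolvable decomposition) is a collection of pairwise edge-disjoint subgraphs of $G$ (called blocks), each isomorphic to $H_1$ or $H_2$, such that every edge of $G$ lies in exactly one block, together with a partition of the blocks into $r+s$ classes (factors), where each class consists of pairwise vertex-disjoint blocks that together cover all vertices of $G$ (i.e. the class is a spanning subgraph of $G$), $r$ of the classes consist only of copies of $H_1$, and $s$ of the classes consist only of copies of $H_2$. *)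

(* Defs.v *)
From mathcomp Require Import all_boot.

Set Implicit Arguments.
Unset Strict Implicit.
Unset Printing Implicit Defensive.

Record sgraph := SGraph {
  vertex :> finType;
  adj : rel vertex;
  adj_sym : symmetric adj;
  adj_irrefl : irreflexive adj
}.

Definition edges (G : sgraph) : {set {set G}} :=
  [set [set x; y] | x in G, y in G & adj x y].

Definition complete_adj (v : nat) : rel 'I_v := fun x y => x != y.

Fact complete_adj_sym v : symmetric (@complete_adj v).
Proof. by move=> x y; rewrite /complete_adj eq_sym. Qed.

Fact complete_adj_irrefl v : irreflexive (@complete_adj v).
Proof. by move=> x; rewrite /complete_adj eqxx. Qed.

Definition complete_graph (v : nat) : sgraph :=
  SGraph (@complete_adj_sym v) (@complete_adj_irrefl v).

(* The center of the star is [ord0]: an edge joins two vertices exactly one  *)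
(* of which is the center.                                                    *)
Definition star_adj (n : nat) : rel 'I_n.+1 :=
  fun x y => (x == ord0) (+) (y == ord0).

Fact star_adj_sym n : symmetric (@star_adj n).
Proof. by move=> x y; rewrite /star_adj addbC. Qed.

Fact star_adj_irrefl n : irreflexive (@star_adj n).
Proof. by move=> x; rewrite /star_adj addbb. Qed.

Definition star_graph (n : nat) : sgraph :=
  SGraph (@star_adj_sym n) (@star_adj_irrefl n).

(* A candidate subgraph is a pair (vertex set, edge set), edges being        *)
(* two-element sets of vertices.                                              *)
Definition block (G : sgraph) : finType := ({set G} * {set {set G}})%type.

Definition bvertices (G : sgraph) (b : block G) : {set G} := b.1.
Definition bedges (G : sgraph) (b : block G) : {set {set G}} := b.2.

Definition is_subgraph (G : sgraph) (b : block G) : Prop :=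
  bedges b \subset edges G /\
  (forall e, e \in bedges b -> e \subset bvertices b).

Definition block_iso (H G : sgraph) (b : block G) : Prop :=
  exists f : H -> G,
    [/\ injective f,
        f @: [set: H] = bvertices b &
        forall x y : H, ([set f x; f y] \in bedges b) = adj x y].

Definition is_decomposition (H1 H2 G : sgraph) (B : {set block G}) : Prop :=
  [/\ forall b, b \in B -> is_subgraph b,
      forall b, b \in B -> block_iso H1 b \/ block_iso H2 b,
      forall b c, b \in B -> c \in B -> b != c ->
        [disjoint bedges b & bedges c] &
      forall e, e \in edges G -> exists! b, b \in B /\ e \in bedges b].

Definition is_factor (G : sgraph) (F : {set block G}) : Prop :=
  (forall b c, b \in F -> c \in F -> b != c ->
     [disjoint bvertices b & bvertices c]) /\
  \bigcup_(b in F) bvertices b = [set: G].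

Definition URD (H1 H2 G : sgraph) (r s : nat) : Prop :=
  exists (B : {set block G}) (P1 P2 : {set {set block G}}),
    [/\ is_decomposition H1 H2 B,
        [/\ partition (P1 :|: P2) B, [disjoint P1 & P2], #|P1| = r & #|P2| = s],
        forall F, F \in P1 :|: P2 -> is_factor F,
        forall F b, F \in P1 -> b \in F -> block_iso H1 b &
        forall F b, F \in P2 -> b \in F -> block_iso H2 b].

(* Main.v *)
Require Import Defs.
From mathcomp Require Import all_boot all_algebra fingroup cyclic zify.

(** Identify the vertices with A x B, where #|A| = m and #|B| = n + 1.

    Both m and n + 1 are even, so the complete graphs on A and on B have
    one-factorizations, with m - 1 and n factors.  The one on B, copied in each
    fibre {a} x B, uses up the edges inside the fibres with n perfect matchings
    ([fibres_decomposable]).  The other edges join (a, b) to (F a, b') for a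
    unique factor F of A, and are handled one or two factors at a time.
    - The edges above one factor F split into n + 1 perfect matchings
      ([blowup_matching_decomposable]): make B a cyclic group and put the edge
      from (a, b) to (F a, b') in the matching number b + b'.
    - The edges above two factors F and G split into n + 1 star factors and two
      perfect matchings ([blowup_two_matchings_decomposable]).  The union of F
      and G is bipartite, hence its edges can be oriented into a permutation,
      next.  For i in B, the star factor number i has centers (a, i), and the
      leaves of (a, i) are the (next a, b) with b <> i: each vertex is a center
      if its second coordinate is i and a leaf otherwise.  This uses the edges
      whose ends have different second coordinates; the remaining ones
      form n + 1 copies of F and n + 1 copies of G.

    One factor of A is treated alone, which leaves m - 2 factors.  Group these
    in pairs; in l pairs both factors are treated alone, and the other
    (m - 2)/2 - l pairs yield stars.  The matchings number
    n + (n + 1) + 2 (n + 1) l + 2 ((m - 2)/2 - l) = 2 n l + (m + 2 n - 1), and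
    the star factors (n + 1) ((m - 2)/2 - l).

    A factor is encoded by the map that sends each vertex to the center of its
    star ([star_map]), one end of each edge serving as the center in a perfect
    matching; a decomposition is a list of such maps, and asks how many of
    them join two given vertices ([decomposable]).  Decompositions of
    edge-disjoint graphs are then combined by concatenation, and multiplicities
    add up ([decomposableD]).  The passage to blocks and classes is
    made once, in [urd_of_decomposable]. *)

Set Implicit Arguments.
Unset Strict Implicit.
Unset Printing Implicit Defensive.

(** * Factors as center maps *)

Section StarMaps.
Variable T : finType.
Implicit Types (g : {ffun T -> T}) (x y z : T).

(** A spanning family of disjoint k-leaf stars, seen as the retraction of the
    vertices onto the centers: the fibre of a center is the vertex set of its
    star. *)
Definition star_map k g :=
  [forall x, (g (g x) == g x) && (#|[set y | g y == g x]| == k.+1)].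

Definition joins g x y := (x != y) && ((g x == y) || (g y == x)).

Lemma star_mapP k g :
  reflect ((forall x, g (g x) = g x) /\ (forall x, #|[set y | g y == g x]| = k.+1))
          (star_map k g).
Proof.
apply: (iffP forallP) => [H|[H1 H2] x]; last by rewrite H1 H2 !eqxx.
by split=> x; have /andP[/eqP ? /eqP ?] := H x.
Qed.

(** [w] is the adjacency of the multigraph to decompose, as a multiplicity:
    with values in nat, unions of graphs become sums. *)
Definition decomposable n (w : T -> T -> nat) r s :=
  exists Ms Ss : seq {ffun T -> T},
    [/\ size Ms = r, size Ss = s, all (star_map 1) Ms, all (star_map n) Ss
      & forall x y, count (fun g => joins g x y) (Ms ++ Ss) = w x y].

Lemma decomposableD n w1 w2 r1 r2 s1 s2 :
  decomposable n w1 r1 s1 -> decomposable n w2 r2 s2 ->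
  decomposable n (fun x y => w1 x y + w2 x y) (r1 + r2) (s1 + s2).
Proof.
move=> [M1 [S1 [<- <- aM1 aS1 e1]]] [M2 [S2 [<- <- aM2 aS2 e2]]].
exists (M1 ++ M2), (S1 ++ S2); rewrite !size_cat !all_cat aM1 aM2 aS1 aS2.
by split=> // x y; rewrite -e1 -e2 !count_cat addnACA.
Qed.

Lemma eq_decomposable n w1 w2 r s :
  w1 =2 w2 -> decomposable n w1 r s -> decomposable n w2 r s.
Proof.
move=> e [Ms [Ss [? ? ? ? c]]]; exists Ms, Ss; split=> // x y; rewrite c; exact: e.
Qed.

Definition perfect_matching (f : T -> T) :=
  [forall x, (f (f x) == x) && (f x != x)].

Lemma perfect_matchingP (f : T -> T) :
  reflect (involutive f /\ forall x, f x != x) (perfect_matching f).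
Proof.
apply: (iffP forallP) => [H|[H1 H2] x]; last by rewrite H1 H2 eqxx.
by split=> x; have /andP[/eqP ? ?] := H x.
Qed.

(** A perfect matching is a factor of one-leaf stars once a center is chosen
    on each edge: here, its end of smaller rank. *)
Definition lower_end (f : T -> T) : {ffun T -> T} :=
  [ffun x => if enum_rank (f x) < enum_rank x then f x else x].

Lemma star_map_lower_end f : perfect_matching f -> star_map 1 (lower_end f).
Proof.
move=> /perfect_matchingP[fK fx].
have ge x : lower_end f (f x) = lower_end f x.
  rewrite !ffunE fK; case: (ltngtP (enum_rank x) (enum_rank (f x))) => //.
  by move/val_inj/enum_rank_inj => /esym/eqP; rewrite (negPf (fx x)).
have gx x : lower_end f x = x \/ lower_end f x = f x.
  by rewrite ffunE; case: ifP; [right|left].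
apply/star_mapP; split=> x.
  by case: (gx x) => e; rewrite [in LHS]e ?ge.
rewrite (_ : [set y | _] = [set x; f x]) ?cards2 1?eq_sym ?fx //.
apply/setP=> y; rewrite !inE; apply/eqP/orP => [|[] /eqP -> //].
case: (gx x) (gx y) => -> [] -> => [| /(canRL fK) | | /(can_inj fK)] ->;
  by rewrite eqxx; auto.
Qed.

Lemma joins_lower_end f x y :
  perfect_matching f -> joins (lower_end f) x y = (f x == y).
Proof.
move=> /perfect_matchingP[fK fx].
have ff u v : (f u == v) = (f v == u) by apply/eqP/eqP => <-; rewrite fK.
rewrite /joins !ffunE; have [->|xy] := eqVneq x y; first by rewrite (negPf (fx y)).
have [e|ne] := eqVneq (f x) y.
  rewrite -e fK; case: (ltngtP (enum_rank x) (enum_rank (f x)));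
    rewrite ?eqxx ?orbT //.
  by move/val_inj/enum_rank_inj => h; case/eqP: xy; rewrite -e -h.
have ne' : f y != x by rewrite ff.
case: ifP; case: ifP; rewrite ?(negPf ne) ?(negPf ne') ?(negPf xy) //;
  by rewrite eq_sym (negPf xy).
Qed.

Lemma matchings_decomposable n (fs : seq {ffun T -> T}) :
  all (fun f : {ffun T -> T} => perfect_matching f) fs ->
  decomposable n (fun x y => count (fun f : {ffun T -> T} => f x == y) fs)
    (size fs) 0.
Proof.
move=> h; exists (map (fun f : {ffun T -> T} => lower_end f) fs), [::].
split; rewrite ?size_map //.
  by rewrite all_map; apply: sub_all h => f; apply: star_map_lower_end.
move=> x y; rewrite cats0 count_map; apply: eq_in_count => f /(allP h).
exact: joins_lower_end.
Qed.

(** Let p = h o f; since f and h are involutions, f conjugates p to its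
    inverse.  If f x were some p^N x, then the middle y = p^(N/2) x of the path
    would satisfy f y = y for N even, and h (f y) = f y for N odd.  So
    x and f x lie in different p-orbits; f and h both exchange these two
    orbits, which are coloured by comparing their representatives. *)
Lemma two_matchings_bipartite (f h : T -> T) :
  perfect_matching f -> perfect_matching h ->
  exists c : T -> bool, forall x, c (f x) = ~~ c x /\ c (h x) = ~~ c x.
Proof.
move=> /perfect_matchingP[fK fx] /perfect_matchingP[hK hx].
pose p := h \o f.
have pI : injective p by apply: inj_comp; exact: can_inj.
have iI k : injective (iter k p) by elim: k => // k IH u v /pI /IH.
have fp k x : iter k p (f (iter k p x)) = f x.
  elim: k x => //= k IH x; rewrite /= -[RHS](IH x) -iterS iterSr /=.
  by congr (iter k p _); rewrite /p /= fK hK.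
have neq x : ~~ fconnect p x (f x).
  apply/negP => /iter_findex; set N := findex _ _ _ => e.
  have: iter N./2 p (f (iter N./2 p x)) =
        iter (odd N) p (iter N./2 p (iter N./2 p x)).
    by rewrite fp -2!iterD -?addnA addnn odd_double_half.
  rewrite -iterD addnC iterD => /iI.
  case: (odd N) => /= E.
    by have := hx (f (iter N./2 p x)); rewrite -[X in X != _]/(p _) -E eqxx.
  by have := fx (iter N./2 p x); rewrite E eqxx.
have sym := fconnect_sym pI.
pose rt x := enum_rank (froot p x).
have rtE x y : fconnect p x y -> rt x = rt y.
  by move=> xy; congr enum_rank; apply/eqP; rewrite root_connect.
have rtne x : rt x <> rt (f x).
  by move/enum_rank_inj/eqP; rewrite root_connect //; apply/negP.
have rtp x : rt (p x) = rt x by apply/esym/rtE/fconnect1.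
have rth x : rt (h x) = rt (f x) by rewrite -(rtp (f x)) /p /= fK.
have rtfh x : rt (f (h x)) = rt x by rewrite -(rtp (f (h x))) /p /= fK hK.
exists (fun x => rt x < rt (f x)) => x.
have E : (rt (f x) < rt x) = ~~ (rt x < rt (f x)).
  by case: ltngtP => // /val_inj /esym /rtne.
by rewrite fK rth rtfh.
Qed.

End StarMaps.

(** * One-factorizations of complete graphs of even order *)

Definition one_factorization (A : finType) (Fs : seq {ffun A -> A}) :=
  all (fun F : {ffun A -> A} => perfect_matching F) Fs /\
  forall a b, count (fun F : {ffun A -> A} => F a == b) Fs = (a != b).

Section CyclicOneFactorization.
Import GRing.Theory.
Local Open Scope ring_scope.
Variables (Z : finZmodType) (oddZ : odd #|Z|).

(** The multiplier is the inverse of 2 modulo the odd number #|Z|. *)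
Let half (c : Z) := c *+ #|Z|.+1./2.

Let halfD (x : Z) : half (x + x) = x.
Proof.
rewrite /half mulrnDl -mulrnDr addnn.
have -> : (#|Z|.+1./2.*2 = #|Z|.+1)%N.
  by rewrite -[RHS]odd_double_half /= oddZ.
rewrite mulrS -[RHS]addr0; congr (_ + _).
have := @expg_cardG Z [set: Z]%G x (in_setT x).
by rewrite cardsT.
Qed.

Let halfK (c : Z) : half c + half c = c.
Proof. by rewrite -mulrnDl; exact: halfD. Qed.

(** The classical factor of index [c]: distinct group elements of sum [c] are
    matched, and the half of [c], which has no partner, is matched with the point
    at infinity [None]. *)
Definition cyclic_matching (c : Z) : {ffun option Z -> option Z} :=
  [ffun u => if u is Some x then if x + x == c then None else Some (c - x)
             else Some (half c)].

Lemma cyclic_one_factorization :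
  one_factorization [seq cyclic_matching c | c <- enum Z].
Proof.
split.
  rewrite all_map; apply/allP => c _ /=; apply/perfect_matchingP; split.
    case=> [x|]; rewrite !ffunE; last by rewrite halfK eqxx.
    case: eqP => [<-|ne]; rewrite ?halfD // subKr; case: eqP => // e.
    have h := halfD (c - x); rewrite e in h; case: ne.
    suff -> : x = half c by exact: halfK.
    by rewrite -[LHS](subKr c) -h -{1}(halfK c) addrK.
  case=> [x|]; rewrite ffunE //; case: (x + x =P c) => // ne.
  by apply/eqP => -[e]; case: ne; rewrite -{1}e subrK.
move=> a b; rewrite count_map.
have cnt1 (d : Z) : count (pred1 d) (enum Z) = 1%N.
  by rewrite count_uniq_mem ?enum_uniq // mem_enum.
case: a b => [x|] [y|]; rewrite ?eqxx.
- have [[->]|xy] /= := eqVneq (Some x) (Some y).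
    rewrite (eq_count (a2 := pred0)) ?count_pred0 // => c /=; rewrite ffunE.
    case: (y + y =P c) => // ne; apply/eqP => -[e]; case: ne.
    by rewrite -{1}e subrK.
  rewrite -[RHS]/1%N -(cnt1 (x + y)); apply: eq_count => c /=; rewrite ffunE.
  case: (x + x =P c) => [<-|ne].
    by apply/esym/negP => /eqP /addrI e; rewrite e eqxx in xy.
  by apply/eqP/eqP => [[<-]|->]; [rewrite addrC subrK|rewrite addrC addKr].
- rewrite -[RHS]/1%N -(cnt1 (x + x)); apply: eq_count => c /=; rewrite ffunE [RHS]eq_sym.
  by case: (x + x == c).
- rewrite -[RHS]/1%N -(cnt1 (y + y)); apply: eq_count => c /=; rewrite ffunE.
  by apply/eqP/eqP => [[<-]|->]; rewrite ?halfK // halfD.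
- rewrite (eq_count (a2 := pred0)) ?count_pred0 // => c /=.
  by rewrite ffunE.
Qed.

End CyclicOneFactorization.

Lemma card_bijection (A B : finType) :
  #|A| = #|B| -> exists2 h : A -> B, injective h & exists k, cancel k h.
Proof.
move=> e; exists (fun a => enum_val (cast_ord e (enum_rank a))).
  by move=> a b /enum_val_inj/cast_ord_inj/enum_rank_inj.
exists (fun b => enum_val (cast_ord (esym e) (enum_rank b))) => b.
by rewrite enum_valK cast_ordKV enum_rankK.
Qed.

Lemma one_factorization_exists (A : finType) q :
  odd q -> #|A| = q.+1 ->
  exists2 Fs : seq {ffun A -> A}, one_factorization Fs & size Fs = q.
Proof.
case: q => // q oddq cA.
have oddZ : odd #|'I_q.+1| by rewrite card_ord.
have [pm cnt] := cyclic_one_factorization oddZ.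
have eqc : #|A| = #|{: option 'I_q.+1}| by rewrite card_option card_ord cA.
have [h hI [k kK]] := card_bijection eqc.
have hK : cancel h k by move=> a; apply: hI; rewrite kK.
pose tr (F : {ffun option 'I_q.+1 -> option 'I_q.+1}) : {ffun A -> A} :=
  [ffun a => k (F (h a))].
set Fs := map _ _ in pm cnt.
exists (map tr Fs); last by rewrite 2!size_map -cardE card_ord.
split.
  rewrite all_map; apply: sub_all pm => F /perfect_matchingP[FK Fx].
  apply/perfect_matchingP; split=> a; rewrite !ffunE; first by rewrite kK FK hK.
  by rewrite -(inj_eq hI) kK.
move=> a b; rewrite count_map -(inj_eq hI) -cnt; apply: eq_count => F /=.
by rewrite ffunE -(inj_eq hI) kK.
Qed.

Lemma decomposable_bij (T U : finType) (h : U -> T) n w r s :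
  bijective h -> decomposable n w r s ->
  decomposable n (fun x y => w (h x) (h y)) r s.
Proof.
move=> [k hK kK] [Ms [Ss [sM sS aM aS cnt]]].
pose tr (g : {ffun T -> T}) : {ffun U -> U} := [ffun u => k (g (h u))].
have hI := can_inj hK; have kI := can_inj kK.
have trS j g : star_map j g -> star_map j (tr g).
  move=> /star_mapP[gg cg]; apply/star_mapP; split=> x.
    by rewrite !ffunE kK gg.
  rewrite -(cg (h x)) -(card_imset _ hI); apply: eq_card => y; rewrite inE.
  apply/imsetP/eqP => [[u]|e].
    by rewrite inE !ffunE => /eqP/kI e ->.
  by exists (k y); rewrite ?inE ?ffunE !kK ?e.
exists (map tr Ms), (map tr Ss); rewrite !size_map sM sS -map_cat.
split=> //.
- by rewrite all_map; apply: sub_all aM => g /trS.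
- by rewrite all_map; apply: sub_all aS => g /trS.
move=> x y; rewrite count_map -cnt; apply: eq_count => g /=.
by rewrite /joins !ffunE (inj_eq hI) -!(inj_eq hI) !kK.
Qed.

(** * Factors of the blow-up A x B *)

Section Blowup.
Variables (A : finType).
Implicit Types F G : A -> A.

Lemma fibres_decomposable (B : finType) n (Fs : seq {ffun B -> B}) :
  one_factorization Fs ->
  decomposable n (fun x y : A * B => (x.1 == y.1) && (x.2 != y.2)) (size Fs) 0.
Proof.
move=> [pm cnt].
pose lift (F : {ffun B -> B}) : {ffun A * B -> A * B} :=
  [ffun x => (x.1, F x.2)].
rewrite -(size_map lift).
have pl : all (fun f : {ffun A * B -> A * B} => perfect_matching f)
              (map lift Fs).
  rewrite all_map; apply: sub_all pm => F /perfect_matchingP[FK Fx].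
  apply/perfect_matchingP; split=> -[a b]; rewrite !ffunE /= ?FK //.
  by rewrite xpair_eqE negb_and Fx orbT.
apply: eq_decomposable (matchings_decomposable n pl) => -[a b] [a' b'] /=.
rewrite count_map; have [->|ne] := eqVneq a a'.
  by rewrite -cnt; apply: eq_count => F /=; rewrite ffunE xpair_eqE eqxx.
rewrite (eq_count (a2 := pred0)) ?count_pred0 // => F /=.
by rewrite ffunE xpair_eqE (negPf ne).
Qed.

(** The edges from (a, b) to (F a, b') with b + b' = i form a matching, for
    each i.  A sum is used rather than a difference because the
    condition is then symmetric in the two ends. *)
Lemma blowup_matching_decomposable (B : finZmodType) n F :
  perfect_matching F ->
  decomposable n (fun x y : A * B => (F x.1 == y.1) : nat) #|B| 0.
Proof.
move=> /perfect_matchingP[FK Fx].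
pose lift (i : B) : {ffun A * B -> A * B} :=
  [ffun x => (F x.1, i - x.2)%R].
rewrite cardE -(size_map lift).
have pl : all (fun f : {ffun A * B -> A * B} => perfect_matching f)
              (map lift (enum B)).
  rewrite all_map; apply/allP => i _.
  apply/perfect_matchingP; split=> -[a b]; rewrite !ffunE /= ?FK ?GRing.subKr //.
  by rewrite xpair_eqE negb_and Fx.
apply: eq_decomposable (matchings_decomposable n pl) => -[a b] [a' b'] /=.
rewrite count_map; have [e|ne] := eqVneq (F a) a'.
  rewrite (eq_count (a2 := pred1 (b' + b)%R)) => [|i /=].
    by rewrite count_uniq_mem ?enum_uniq ?mem_enum.
  by rewrite ffunE xpair_eqE e eqxx /= GRing.subr_eq.
rewrite (eq_count (a2 := pred0)) ?count_pred0 // => i /=.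
by rewrite ffunE xpair_eqE (negPf ne).
Qed.

(** The colouring of [two_matchings_bipartite] orients the edges, so that each
    cycle of F u G is traversed in one direction: from [c]-vertices along G,
    from the others along F.  The center of a leaf (a, b) of the star factor i
    is (prev a, i). *)
Lemma blowup_two_matchings_decomposable (B : finType) n F G :
  perfect_matching F -> perfect_matching G -> #|B| = n.+1 ->
  decomposable n (fun x y : A * B => (F x.1 == y.1) + (G x.1 == y.1)) 2 n.+1.
Proof.
move=> pF pG cB; have [c cP] := two_matchings_bipartite pF pG.
have [/perfect_matchingP[FK Fx] /perfect_matchingP[GK Gx]] := (pF, pG).
have cF x : c (F x) = ~~ c x by case: (cP x).
have cG x : c (G x) = ~~ c x by case: (cP x).
pose prev x := if c x then F x else G x.
pose next x := if c x then G x else F x.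
have nextK : cancel next prev.
  by move=> x; rewrite /prev /next; case cx: (c x); rewrite ?cF ?cG cx ?FK ?GK.
have prevK : cancel prev next.
  by move=> x; rewrite /prev /next; case cx: (c x); rewrite ?cF ?cG cx ?FK ?GK.
have prev_next x y : (prev y == x) = (next x == y).
  by apply/eqP/eqP => <-; rewrite ?prevK ?nextK.
have FG x y : (F x == y) + (G x == y) = (prev x == y) + (prev y == x).
  by rewrite (prev_next x y) /prev /next; case: (c x); rewrite // addnC.
pose star (i : B) : {ffun A * B -> A * B} :=
  [ffun x => (if x.2 == i then x.1 else prev x.1, i)].
have starS i : star_map n (star i).
  apply/star_mapP; split=> -[a b]; first by rewrite !ffunE eqxx.
  set z := (star i (a, b)).1.
  pose leaf b' := (if b' == i then z else next z, b').
  have leafI : injective leaf by move=> u v [].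
  rewrite -cB -cardsT -(card_imset _ leafI); apply: eq_card => -[x y]; rewrite inE.
  have -> : star i (a, b) = (z, i) by rewrite /z ffunE.
  rewrite ffunE xpair_eqE eqxx andbT /=; apply/eqP/imsetP => [e|[y' _ [-> ->]]].
    by exists y; rewrite // /leaf; case: (y == i) e => <-; rewrite ?prevK.
  by case: (y' == i); rewrite ?nextK.
pose lift (f : A -> A) : {ffun A * B -> A * B} := [ffun x => (f x.1, x.2)].
have lP f : perfect_matching f -> perfect_matching (lift f).
  move=> /perfect_matchingP[fK fx]; apply/perfect_matchingP.
  split=> -[a b]; rewrite !ffunE /= ?fK //.
  by rewrite xpair_eqE negb_and fx.
exists [:: lower_end (lift F); lower_end (lift G)], (map star (enum B)).
rewrite size_map -cardE cB; split=> //.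
- by rewrite /= !star_map_lower_end ?lP.
- by rewrite all_map; apply/allP => i _ /=.
move=> [a b] [a' b']; rewrite /= count_map !joins_lower_end ?lP // !ffunE /=.
rewrite !xpair_eqE /=.
have cnt1 (d : B) : count (pred1 d) (enum B) = 1.
  by rewrite count_uniq_mem ?enum_uniq // mem_enum.
have [->|ne] := eqVneq b b'.
  rewrite !andbT (eq_count (a2 := pred0)) ?count_pred0 ?addn0 // => i /=.
  rewrite /joins !ffunE /= !xpair_eqE !eqxx /=.
  case: (eqVneq b' i) => _; rewrite /= ?andbT ?andbF //.
  by rewrite (eq_sym a' a) orbb andNb.
rewrite !andbF !add0n FG.
have cntP (P : bool) d : count (fun i => P && (i == d)) (enum B) = P.
  by case: P; rewrite /= ?cnt1 // count_pred0.
(* With b != b', only the star factors [b'] and [b] can join the two vertices: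
   the vertex whose second coordinate is the index has to be the center. *)
rewrite -(cntP (prev a == a') b') -(cntP (prev a' == a) b) -count_predUI addnC.
rewrite [X in X + _](eq_count (a2 := pred0)) ?count_pred0 ?add0n => [|i /=]; last first.
  case: (eqVneq i b') => [->|_]; last by rewrite andbF.
  by rewrite [b' == b]eq_sym (negPf ne) !andbF.
apply: eq_count => i; rewrite /= /joins !ffunE /= !xpair_eqE (negPf ne) andbF /=.
have [ei|_] := eqVneq b i; have [e'|_] := eqVneq b' i; rewrite /= ?andbT ?andbF ?orbF //.
by case/eqP: ne; rewrite ei e'.
Qed.

(** Among the [p] pairs of factors, the first [l] give matchings only, that is
    2 (n + 1) of them per pair, and each other pair gives two matchings and
    n + 1 star factors. *)
Lemma blowup_matchings_decomposable (B : finZmodType) n p l (Fs : seq {ffun A -> A}) :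
  #|B| = n.+1 -> size Fs = p.*2 -> l <= p ->
  all (fun F : {ffun A -> A} => perfect_matching F) Fs ->
  decomposable n
    (fun x y : A * B => count (fun F : {ffun A -> A} => F x.1 == y.1) Fs)
    (2 * n * l + p.*2) (n.+1 * (p - l)).
Proof.
move=> cB; elim: p l Fs => [|p IH] l.
  case=> // _; rewrite leqn0 => /eqP -> _.
  by exists [::], [::]; split; rewrite //= ?muln0.
case=> [//|F [//|G Fs]] [szFs] lp /= /and3P[pF pG pFs].
case: l lp => [_|l lp].
  have := decomposableD (blowup_two_matchings_decomposable pF pG cB)
    (IH 0 Fs szFs (leq0n _) pFs).
  rewrite muln0 !add0n !subn0 mulnS doubleS -add2n => D.
  by apply: eq_decomposable D => x y /=; rewrite addnA.
have := decomposableD (blowup_matching_decomposable B n pF)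
   (decomposableD (blowup_matching_decomposable B n pG) (IH l Fs szFs lp pFs)).
rewrite cB subSS !add0n.
rewrite (_ : n.+1 + _ = 2 * n * l.+1 + p.+1.*2); last by rewrite doubleS; nia.
by apply: eq_decomposable.
Qed.
End Blowup.

(** * From center maps to uniformly resolvable decompositions *)

Lemma count_le1_eq (X : eqType) (p : pred X) (s : seq X) (a b : X) :
  count p s <= 1 -> a \in s -> b \in s -> p a -> p b -> a = b.
Proof.
rewrite -size_filter => sz sa sb pa pb.
have: a \in filter p s by rewrite mem_filter pa.
have: b \in filter p s by rewrite mem_filter pb.
by case: filter sz => [|c [|]] // _; rewrite !inE => /eqP -> /eqP ->.
Qed.

Lemma set2_eqP (X : finType) (x y u v : X) :
  [set x; y] = [set u; v] -> (x = u /\ y = v) \/ (x = v /\ y = u).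
Proof.
move=> e; have [Hx Hy] : x \in [set u; v] /\ y \in [set u; v].
  by rewrite -e !inE !eqxx orbT.
have [Hu Hv] : u \in [set x; y] /\ v \in [set x; y].
  by rewrite e !inE !eqxx orbT.
move: Hx Hy Hu Hv; rewrite !inE.
move=> /orP[]/eqP-> /orP[]/eqP->; rewrite ?orbb; auto.
  by move=> _ /eqP ->; auto.
by move=> /eqP ->; auto.
Qed.

Section StarBlocks.
Variable G : sgraph.
Implicit Types (g : {ffun G -> G}) (x y z : G).

Definition star_block g z : block G :=
  ([set y | g y == z], [set [set z; y] | y in [set y | g y == z] :\ z]).

Definition star_factor g : {set block G} :=
  [set star_block g z | z in [set z | g z == z]].

Lemma mem_star_block g z x y :
  (forall u, g (g u) = g u) -> g z = z ->
  ([set x; y] \in bedges (star_block g z)) = joins g x y && (g x == z).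
Proof.
move=> gg gz; apply/imsetP/andP => [[u]|[]].
  rewrite !inE => /andP[uz /eqP gu] /set2_eqP[] [-> ->].
    by rewrite /joins gz gu eq_sym uz !eqxx orbT.
  by rewrite /joins gz gu uz !eqxx.
rewrite /joins => /andP[xy /orP[] /eqP e] /eqP gx.
  exists x; last by rewrite -e gx setUC.
  by rewrite !inE gx eqxx andbT -gx e.
have ex : x = z by rewrite -gx -e gg.
by exists y; rewrite ?ex // !inE e ex eqxx andbT -ex eq_sym.
Qed.

Lemma star_block_edgeP g z e :
  e \in bedges (star_block g z) -> exists x y, e = [set x; y].
Proof. by case/imsetP=> y _ ->; exists z, y. Qed.

Lemma star_block_iso k g z :
  star_map k g -> g z = z -> block_iso (star_graph k) (star_block g z).
Proof.
move=> /star_mapP[gg cg] gz.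
(* The center comes first, so that it is the image of [ord0]. *)
set s := enum ([set y | g y == z] :\ z).
have us : uniq (z :: s) by rewrite /= enum_uniq mem_enum !inE eqxx.
have sz : size (z :: s) = k.+1.
  rewrite /= -cardE -(cg z) gz [in RHS](cardsD1 z) inE gz eqxx //.
have ms x : (x \in z :: s) = (g x == z).
  by rewrite inE mem_enum !inE; case: eqP => // ->; rewrite gz eqxx.
pose f (i : 'I_k.+1) := nth z (z :: s) i.
have fI : injective f.
  by move=> i j /eqP; rewrite nth_uniq ?sz // => /eqP/val_inj.
have gf i : g (f i) = z by apply/eqP; rewrite -ms mem_nth ?sz.
have f0 i : (z == f i) = (i == ord0).
  by rewrite -(inj_eq fI) eq_sym.
exists f; split=> //.
  apply/setP=> x; rewrite inE -ms; apply/imsetP/idP => [[i _ ->]|xs].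
    by rewrite mem_nth ?sz.
  have lt : index x (z :: s) < k.+1 by rewrite -sz index_mem.
  by exists (Ordinal lt); rewrite // /f nth_index.
move=> i j; rewrite mem_star_block // /joins !gf eqxx andbT !f0 (inj_eq fI).
rewrite /= /star_adj.
have [->|ij] := eqVneq i j; first by rewrite addbb.
have [i0|] := eqVneq i ord0; have [j0|] := eqVneq j ord0 => //.
by case/eqP: ij; rewrite i0 j0.
Qed.

Lemma edge_star_block_iso g z :
  star_map 1 g -> g z = z -> block_iso (complete_graph 2) (star_block g z).
Proof.
move=> sg gz; have [f [fI fV fE]] := star_block_iso sg gz.
exists f; split=> // x y; rewrite fE /= /star_adj /complete_adj.
by case: x y => -[|[|//]] ? [] [|[|//]] ?.
Qed.

(** Two vertices are joined by at most one map of the list, and each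
    star has an edge because n > 0.  So the maps of the list are pairwise
    distinct, and a block remembers its map and its center: counting blocks or
    classes is counting maps. *)
Lemma urd_of_decomposable n r s :
  0 < n -> 0 < #|G| ->
  decomposable n (fun x y : G => adj x y : nat) r s ->
  URD (complete_graph 2) (star_graph n) G r s.
Proof.
move=> n_gt0 /card_gt0P[x0 _] [Ms [Ss [<- <- /allP aM /allP aS cnt]]].
set L := Ms ++ Ss in cnt.
have starL g : g \in L -> exists2 k, 0 < k & star_map k g.
  by rewrite mem_cat => /orP[/aM|/aS] ?; [exists 1 | exists n].
have idemL g x : g \in L -> g (g x) = g x.
  by case/starL => k _ /star_mapP[].
have adjL g x y : g \in L -> joins g x y -> adj x y.
  move=> gL gxy; have: 0 < count (fun g => joins g x y) L.
    by rewrite -has_count; apply/hasP; exists g.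
  by rewrite cnt; case: adj.
have uniqL g g' x y : g \in L -> g' \in L -> joins g x y -> joins g' x y -> g = g'.
  by apply: (@count_le1_eq _ (fun g => joins g x y)); rewrite cnt leq_b1.
have edgeL g z : g \in L -> exists2 y, joins g (g z) y & g y = g z.
  move=> gL; have [k k0 /star_mapP[gg cg]] := starL _ gL.
  have: 0 < #|[set y | g y == g z] :\ g z|.
    by move: (cg z); rewrite (cardsD1 (g z)) inE gg eqxx add1n => -[->].
  case/card_gt0P=> y; rewrite !inE => /andP[yz /eqP gy]; exists y => //.
  by rewrite /joins eq_sym yz gy eqxx orbT.
have uL : uniq L.
  apply: count_mem_uniq => g; case gL: (g \in L); last first.
    by apply/count_memPn; rewrite gL.
  have [y jy _] := edgeL _ x0 gL; apply/eqP.
  rewrite eqn_leq -has_count has_pred1 gL andbT.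
  (* The copies of [g] in the list all join the ends of an edge of [g]. *)
  apply: (@leq_trans (count (fun h => joins h (g x0) y) L)); last first.
    by rewrite cnt leq_b1.
  by apply: sub_count => h /= /eqP ->.
have idemL' g : g \in L -> forall x, g (g x) = g x by move=> gL x; exact: idemL.
have shared g g' z z' e : g \in L -> g' \in L -> g z = z -> g' z' = z' ->
    e \in bedges (star_block g z) -> e \in bedges (star_block g' z') ->
    g = g' /\ z = z'.
  move=> gL gL' gz gz' eg; have [x [y exy]] := star_block_edgeP eg.
  move: eg; rewrite exy !mem_star_block; auto; move=> /andP[j /eqP e1] /andP[j' /eqP e2].
  have gg' := uniqL _ _ _ _ gL gL' j j'; split=> //.
  by rewrite -e1 gg' e2.
have edge_block g z : g \in L -> g z = z ->
    exists e, e \in bedges (star_block g z).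
  move=> gL gz; have [y jy _] := edgeL _ z gL.
  exists [set z; y]; rewrite mem_star_block; [|exact: idemL'|by []].
  by rewrite -{1}gz jy gz eqxx.
have block_inj g g' z z' : g \in L -> g' \in L -> g z = z -> g' z' = z' ->
    star_block g z = star_block g' z' -> g = g' /\ z = z'.
  move=> gL gL' gz gz' e; have [ed edP] := edge_block _ _ gL gz.
  by apply: (shared _ _ _ _ ed) => //; rewrite -e.
have factorP g b :
    reflect (exists2 z, g z = z & b = star_block g z) (b \in star_factor g).
  apply: (iffP imsetP) => -[z]; first by rewrite inE => /eqP; exists z.
  by move=> gz ->; exists z; rewrite // inE gz.
have factor_ne g : g \in L -> star_block g (g x0) \in star_factor g.
  by move=> gL; apply/factorP; exists (g x0); rewrite ?idemL.
have factor_meet g g' b : g \in L -> g' \in L ->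
    b \in star_factor g -> b \in star_factor g' -> g = g'.
  move=> gL gL' /factorP[z gz ->] /factorP[z' gz'].
  by case/(block_inj _ _ _ _ gL gL' gz gz').
have factor_inj : {in L &, injective star_factor}.
  move=> g g' gL gL' e; apply: (factor_meet _ _ (star_block g (g x0))) => //.
    exact: factor_ne.
  by rewrite -e; exact: factor_ne.
pose P1 := [set F in map star_factor Ms]; pose P2 := [set F in map star_factor Ss].
pose B := [set b in flatten (map (fun g => enum (star_factor g)) L)].
have BP b :
    reflect (exists g z, [/\ g \in L, g z = z & b = star_block g z]) (b \in B).
  rewrite inE; apply: (iffP flatten_mapP) => [[g gL]|[g [z [gL gz ->]]]].
    by rewrite mem_enum => /factorP[z gz ->]; exists g, z.
  by exists g; rewrite // mem_enum; apply/factorP; exists z.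
have PP F :
    reflect (exists2 g, g \in L & F = star_factor g) (F \in P1 :|: P2).
  by rewrite !inE -mem_cat -map_cat; exact: mapP.
move: (uL); rewrite cat_uniq => /and3P[uM dMS uS].
have sML g : g \in Ms -> g \in L by rewrite mem_cat => ->.
have sSL g : g \in Ss -> g \in L by rewrite mem_cat => ->; rewrite orbT.
exists B, P1, P2; split.
- split.
  + move=> b /BP[g [z [gL gz ->]]]; split.
      apply/subsetP=> e eb; have [x [y exy]] := star_block_edgeP eb.
      move: eb; rewrite exy mem_star_block; auto; move=> /andP[/(adjL _ _ _ gL) xy _].
      by apply/imset2P; exists x y; rewrite ?inE.
    move=> e /imsetP[y]; rewrite !inE => /andP[_ /eqP gy] ->.
    by apply/subsetP=> u; rewrite !inE => /orP[]/eqP ->; rewrite ?gz ?gy.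
  + move=> b /BP[g [z [gL gz ->]]]; move: (gL); rewrite mem_cat => /orP[/aM|/aS] sg.
      by left; apply: edge_star_block_iso.
    by right; apply: star_block_iso.
  + move=> b c /BP[g [z [gL gz ->]]] /BP[g' [z' [gL' gz' ->]]] ne.
    rewrite -setI_eq0; apply/eqP/setP=> e; rewrite !inE; apply/negP=> /andP[e1 e2].
    have [E1 E2] := shared _ _ _ _ _ gL gL' gz gz' e1 e2.
    by case/eqP: ne; rewrite E1 E2.
  + move=> e /imset2P[x y _]; rewrite inE => xy exy.
    have /hasP[g gL jg] : has (fun g => joins g x y) L.
      by rewrite has_count cnt; move: xy; case: adj.
    have eb : e \in bedges (star_block g (g x)).
      by rewrite exy mem_star_block ?jg ?eqxx; auto.
    exists (star_block g (g x)); split.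
      by split=> //; apply/BP; exists g, (g x); rewrite idemL.
    move=> c [/BP[g' [z' [gL' gz' ->]]] ec].
    by have [-> ->] := shared _ _ _ _ _ gL gL' (idemL _ _ gL) gz' eb ec.
- split.
  + apply/and3P; split.
    * rewrite eqEsubset; apply/andP; split; apply/subsetP => b.
        case/bigcupP=> F /PP[g gL ->] /factorP[z gz ->].
        by apply/BP; exists g, z.
      move=> /BP[g [z [gL gz ->]]]; apply/bigcupP; exists (star_factor g).
        by apply/PP; exists g.
      by apply/factorP; exists z.
    * apply/trivIsetP => F F' /PP[g gL ->] /PP[g' gL' ->] ne.
      rewrite -setI_eq0; apply/eqP/setP=> b; rewrite !inE; apply/negP=> /andP[b1 b2].
      by case/eqP: ne; rewrite (factor_meet _ _ _ gL gL' b1 b2).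
    * apply/negP=> /PP[g gL e0]; have := factor_ne _ gL.
      by rewrite -e0 inE.
  + rewrite -setI_eq0; apply/eqP/setP=> F; rewrite !inE; apply/negP.
    move=> /andP[/mapP[g gM ->] /mapP[g' gS e]].
    have gg' := factor_inj _ _ (sML _ gM) (sSL _ gS) e.
    by case/hasP: dMS; exists g'; rewrite // -gg'.
  + rewrite cardsE (card_uniqP _) ?size_map // map_inj_in_uniq //.
    move=> g g' /sML ? /sML.
    exact: factor_inj.
  + rewrite cardsE (card_uniqP _) ?size_map // map_inj_in_uniq //.
    move=> g g' /sSL ? /sSL.
    exact: factor_inj.
- move=> F /PP[g gL ->]; split.
    move=> b c /factorP[z gz ->] /factorP[z' gz' ->] ne.
    rewrite -setI_eq0; apply/eqP/setP=> x; rewrite !inE; apply/negP.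
    by move=> /andP[/eqP e1 /eqP e2]; case/eqP: ne; rewrite -e1 -e2.
  apply/setP=> x; rewrite !inE; apply/bigcupP; exists (star_block g (g x)).
    by apply/factorP; exists (g x); rewrite ?idemL.
  by rewrite inE.
- move=> F b; rewrite inE => /mapP[g /aM sg ->] /factorP[z gz ->].
  exact: edge_star_block_iso.
- move=> F b; rewrite inE => /mapP[g /aS sg ->] /factorP[z gz ->].
  exact: star_block_iso.
Qed.

End StarBlocks.

Theorem theorem5p2 (n m l : nat) (hn : 3 <= n) (hn_odd : odd n)
    (hm : 4 <= m) (hm_even : ~~ odd m) (hl : l <= (m - 2) %/ 2) :
  URD (complete_graph 2) (star_graph n) (complete_graph (m * (n + 1)))
    (2 * n * l + (m + 2 * n - 1))
    ((n + 1) * ((m - 2) %/ 2 - l)).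
Proof.
have [p em] : exists p, m = p.+1.*2.
  exists (m./2.-1); move: (odd_double_half m) hm hm_even.
  by case: odd; case: m./2 => //=; lia.
have el : (m - 2) %/ 2 = p by rewrite em; lia.
rewrite el in hl *.
have [//||Fs [pmF cntF] szF] := @one_factorization_exists 'I_m p.*2.+1.
- by rewrite /= odd_double.
- by rewrite card_ord em doubleS.
have [|Hs Hfact szH] := @one_factorization_exists 'I_n.+1 n hn_odd.
  by rewrite card_ord.
have [|h hI [k kK]] := @card_bijection 'I_(m * (n + 1)) ('I_m * 'I_n.+1)%type.
  by rewrite card_prod !card_ord addn1.
have hbij : bijective h by exists k => // x; apply: hI; rewrite kK.
apply: urd_of_decomposable; [lia | by rewrite card_ord; lia |].
(* The factor [F] is the one treated alone. *)
case: Fs pmF cntF szF => // F Fs /= /andP[pF pFs] cntF [szF].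
have D := decomposableD (fibres_decomposable 'I_m n Hfact)
  (decomposableD (blowup_matching_decomposable 'I_n.+1 n pF)
     (blowup_matchings_decomposable (card_ord n.+1) szF hl pFs)).
have := decomposable_bij hbij D.
rewrite szH card_ord !add0n.
rewrite (_ : n + (n.+1 + _) = 2 * n * l + (m + 2 * n - 1)); last by rewrite em; lia.
have -> : (n + 1) * (p - l) = n.+1 * (p - l) by rewrite addn1.
apply: eq_decomposable => x y.
rewrite cntF /= /complete_adj -(inj_eq hI).
case: (h x) (h y) => [a b] [a' b'] /=; rewrite xpair_eqE.
by case: eqVneq; case: eqVneq.
Qed.
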